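(* Let $m\ge 2$ and $d$ be integers with $m/2<d\le m$, and consider the $(m,d)$ algorithm on the complete graph on $N$ nodes. For $x\in(0,1]$ let $Z_x$ be a random variable with the Binomial$(m,x)$ distribution and define $$g(x)=\frac{x\,\mathbb{P}(Z_x\le m-d)}{(1-x)\,\mathbb{P}(Z_x\ge d)}\in\mathbb{R}^+\cup\{+\infty\},$$ with $g(0)=+\infty$. Then $g(x)>1$ for all $x\in[0,1/2)$, and for all $\alpha\in(0,1/2)$, $$\limsup_{N\to\infty}\frac1N\log h_N(\alpha)\le-\int_\alpha^{1/2}\log g(x)\,dx.$$
   Context: The $(m,d)$ algorithm (integers $1\le d\le m$) on the complete graph on $N$ nodes: each node has a state in $\{0,1\}$ and an independent unit-rate exponential clock, independent of all states. At each tick of its clock, a node samples $m$ nodes uniformly at random from all $N$ nodes, with replacement, and observes their current states; if at least $d$ of the sampled nodes have a state different from its own, it switches its state, otherwise it keeps it. The number $X(t)$ of nodes in state 1 is a continuous-time Markov chain on $\{0,\ldots,N\}$ with rates $q_{n,n+1}=(N-n)\mathbb{P}(\mathrm{Bin}(m,n/N)\ge d)$ and $q_{n,n-1}=n\,\mathbb{P}(\mathrm{Bin}(m,(N-n)/N)\ge d)$; $0$ and $N$ are absorbing and $X(\infty)$ is the absorbing state eventually reached. For $\alpha=i/N$, $i\in\{0,\ldots,N\}$, $h_N(\alpha)=\mathbb{P}(X(\infty)=N\mid X(0)=\lfloor\alpha N\rfloor)$; for general $\alpha\in[0,1]$, $h_N(\alpha)=(N\alpha-\lfloor N\alpha\rfloor)h_N(\lceil\alpha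 N\rceil/N)+(\lceil N\alpha\rceil-N\alpha)h_N(\lfloor\alpha N\rfloor/N)$. *)

(* Defs.v *)
From mathcomp Require Import all_boot all_order all_algebra.
From mathcomp Require Import all_classical all_reals all_analysis.
Set Implicit Arguments. Unset Strict Implicit. Unset Printing Implicit Defensive.
Import Order.TTheory GRing.Theory Num.Theory numFieldNormedType.Exports.
Local Open Scope ring_scope.

Section MD.
Variable R : realType.

Definition binom_ge (m : nat) (p : R) (d : nat) : R :=
  \sum_(d <= k < m.+1) ('C(m, k))%:R * p ^+ k * (1 - p) ^+ (m - k).

Definition binom_le (m : nat) (p : R) (j : nat) : R :=
  \sum_(0 <= k < j.+1) ('C(m, k))%:R * p ^+ k * (1 - p) ^+ (m - k).

Definition rate_up (m d N n : nat) : R :=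
  (N - n)%:R * binom_ge m (n%:R / N%:R) d.
Definition rate_down (m d N n : nat) : R :=
  n%:R * binom_ge m ((N - n)%:R / N%:R) d.

(* One step of the embedded jump chain acting on functions of the state:
   (step f) n = sum_j P(n,j) f j ; 0 and N are absorbing. *)
Definition jump_step (m d N : nat) (f : nat -> R) (n : nat) : R :=
  if (n == 0)%N || (N <= n)%N then f n
  else (rate_up m d N n * f n.+1 + rate_down m d N n * f n.-1)
       / (rate_up m d N n + rate_down m d N n).

Definition prob_at_N_after (m d N k n : nat) : R :=
  iter k (jump_step m d N) (fun j => (j == N)%:R) n.

(* P(X(oo) = N | X(0) = n) : limit over the number of jumps *)
Definition absorb_prob (m d N n : nat) : R :=
  limn (fun k => prob_at_N_after m d N k n).

Definition hN (m d N : nat) (alpha : R) : R :=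
  let x := alpha * N%:R in
  let lo := Num.truncn x in
  if x == lo%:R then absorb_prob m d N lo
  else (x - lo%:R) * absorb_prob m d N lo.+1
       + (lo.+1%:R - x) * absorb_prob m d N lo.

Definition gfun (m d : nat) (x : R) : \bar R :=
  if x == 0 then +oo%E
  else ((x * binom_le m x (m - d)) / ((1 - x) * binom_ge m x d))%:E.

End MD.

(* Main.v *)
(* The ratio of the down rate to the up rate at [k] is [g (k / N)], so with
   [P j := g (1 / N) * ... * g (j / N)] the map [n |-> \sum_(j < n) P j] is
   harmonic for the jump chain; normalised at [N] it dominates the indicator of
   [N], hence the absorption probability.  Pairing the terms [x ^ k (1 - x) ^ l]
   shows that [g] is nonincreasing and at least 1 on [(0, 1/2]], so for
   [l = floor (alpha * N)] and [M = floor (N / 2)] the normalised sum at [l + 1]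
   is at most [(l + 1) * P l / P M].  Its logarithm divided by [N] is
   [ln (l + 1) / N] minus a Riemann sum, which by monotonicity dominates
   [\int_alpha^(1/2) ln g] up to [O(1 / N)]. *)

Require Import Defs.
From mathcomp Require Import all_boot all_order all_algebra.
From mathcomp Require Import all_classical all_reals all_analysis.
From mathcomp Require Import measurable_realfun.
From mathcomp Require Import lra ring zify.
Import Order.TTheory GRing.Theory Num.Theory numFieldNormedType.Exports.
Local Open Scope classical_set_scope.
Local Open Scope ring_scope.

(** * Binomial tails and the function g *)

Lemma binom_ge_ge0 {R : realType} m d (x : R) : 0 <= x <= 1 -> 0 <= binom_ge m x d.
Proof.
move=> /andP[x0 x1]; apply: sumr_ge0 => k _.
by rewrite !mulr_ge0 ?exprn_ge0 ?subr_ge0.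
Qed.

Lemma binom_ge_gt0 {R : realType} m d (x : R) :
  0 < x <= 1 -> (d <= m)%N -> 0 < binom_ge m x d.
Proof.
move=> /andP[x0 x1] dm; rewrite /binom_ge big_nat_recr//= ltr_wpDl//.
  by apply: sumr_ge0 => k _; rewrite !mulr_ge0 ?exprn_ge0 ?subr_ge0// ltW.
by rewrite binn subnn expr0 mulr1 mul1r exprn_gt0.
Qed.

(** Exchange of successes and failures, k -> m - k. It expresses g through a single upper tail,
    taken at x and at 1 - x. *)
Lemma binom_ge_onem {R : realType} m d (x : R) : (d <= m)%N ->
  binom_ge m (1 - x) d = binom_le m x (m - d).
Proof.
move=> dm; rewrite /binom_ge /binom_le big_nat_rev /= -{1}(add0n d) big_addn.
rewrite subSn//; apply: eq_big_nat => k /andP[_ km].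
have -> : (d + m.+1 - (k + d).+1 = m - k)%N by lia.
by rewrite subKr bin_sub ?subKn; [rewrite mulrAC|lia|lia].
Qed.

Lemma gfun_fineE {R : realType} m d (x : R) : (d <= m)%N -> x != 0 ->
  fine (gfun m d x) = (x * binom_ge m (1 - x) d) / ((1 - x) * binom_ge m x d).
Proof. by move=> dm x0; rewrite /gfun (negbTE x0)/= binom_ge_onem. Qed.

(** Since 2k > m for k >= d, the k-th terms of the two sides share the factor C(m,k) (x y)^(m-k+1)
    with y = 1 - x, which leaves x^(2k-m-1) against y^(2k-m-1). *)
Lemma binom_ge_odds_lt {R : realType} m d (x : R) :
  (2 <= m)%N -> (m < 2 * d)%N -> (d <= m)%N -> 0 < x < 2^-1 ->
  (1 - x) * binom_ge m x d < x * binom_ge m (1 - x) d.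
Proof.
move=> m2 md dm /andP[x0 xh].
have xy : x < 1 - x by lra.
have y0 : 0 < 1 - x by lra.
rewrite /binom_ge !mulr_sumr !subKr; set y := 1 - x in xy y0 *.
have E k : (d <= k < m.+1)%N ->
    (y * ('C(m, k)%:R * x ^+ k * y ^+ (m - k)) =
      'C(m, k)%:R * (x * y) ^+ (m - k).+1 * x ^+ (k - (m - k).+1)) *
    (x * ('C(m, k)%:R * y ^+ k * x ^+ (m - k)) =
      'C(m, k)%:R * (x * y) ^+ (m - k).+1 * y ^+ (k - (m - k).+1)).
  move=> /andP[dk km]; have hk z : z ^+ k = z ^+ (m - k).+1 * z ^+ (k - (m - k).+1) :> R.
    by rewrite -exprD; congr (_ ^+ _); lia.
  by rewrite !hk exprMn !exprS; split; ring.
rewrite !big_nat_recr//=; apply: ler_ltD.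
  apply: ler_sum_nat => k /andP[dk km]; rewrite !E; [|lia..].
  rewrite ler_wpM2l ?mulr_ge0 ?exprn_ge0 ?mulr_ge0 ?(ltW x0) ?(ltW y0)//.
  by rewrite lerXn2r ?nnegrE ?(ltW x0) ?(ltW y0) ?(ltW xy).
(* The top term k = m gives strictness: its exponent m - 1 is positive because m >= 2. *)
rewrite !E; [|lia..].
rewrite ltr_pM2l; last by rewrite binn mul1r exprn_gt0 ?mulr_gt0.
by rewrite ltrXn2r ?nnegrE ?(ltW x0) ?(ltW y0)// -lt0n subn_gt0; lia.
Qed.

Lemma gfun_gt1 {R : realType} m d (x : R) :
  (2 <= m)%N -> (m < 2 * d)%N -> (d <= m)%N -> 0 <= x < 2^-1 ->
  (1%:E < gfun m d x)%E.
Proof.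
move=> m2 md dm /andP[x0 xh]; rewrite /gfun; case: eqVneq => [_|xn0].
  exact: ltry.
have x_gt0 : 0 < x by rewrite lt_def xn0.
rewrite lte_fin -binom_ge_onem// ltr_pdivlMr ?mul1r.
  by apply: binom_ge_odds_lt => //; rewrite x_gt0.
by rewrite mulr_gt0 ?binom_ge_gt0//; lra.
Qed.

Lemma gfun_ge1 {R : realType} m d (x : R) :
  (2 <= m)%N -> (m < 2 * d)%N -> (d <= m)%N -> 0 < x <= 2^-1 ->
  1 <= fine (gfun m d x).
Proof.
move=> m2 md dm /andP[x0]; rewrite le_eqVlt => /predU1P[->|xh].
  (* At x = 1/2 numerator and denominator coincide, so g = 1. *)
  rewrite gfun_fineE//; have -> : 1 - 2^-1 = 2^-1 :> R by lra.
  by rewrite divff// mulf_neq0// gt_eqF// binom_ge_gt0//; lra.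
have := @gfun_gt1 R m d x m2 md dm; rewrite (ltW x0) xh => /(_ isT).
by rewrite /gfun gt_eqF//= lte_fin => /ltW.
Qed.

Lemma gfun_gt0 {R : realType} m d (x : R) :
  (d <= m)%N -> 0 < x < 1 -> 0 < fine (gfun m d x).
Proof.
move=> dm /andP[x0 x1]; rewrite gfun_fineE ?gt_eqF//.
by rewrite divr_gt0// mulr_gt0 ?binom_ge_gt0//; lra.
Qed.

(** After cross-multiplication both sides are double sums over k, l >= d. The (k, l) terms share the
    factor [c]; what remains is (x (1 - y))^e against (y (1 - x))^e, and x <= y decides. *)
Lemma gfun_nonincreasing {R : realType} m d (x y : R) :
  (m < 2 * d)%N -> (d <= m)%N -> 0 < x -> x <= y -> y < 1 ->
  fine (gfun m d y) <= fine (gfun m d x).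
Proof.
move=> md dm x0 xy y1; have y0 := lt_le_trans x0 xy; have x1 := le_lt_trans xy y1.
have den_gt0 z : 0 < z -> z < 1 -> 0 < (1 - z) * binom_ge m z d.
  by move=> z0 z1; rewrite mulr_gt0 ?subr_gt0 ?binom_ge_gt0 ?z0 ?ltW.
rewrite !gfun_fineE ?gt_eqF// ler_pdivrMr ?den_gt0//.
rewrite [leRHS]mulrAC ler_pdivlMr ?den_gt0//.
rewrite /binom_ge !mulr_sumr.
have x'0 : 0 <= 1 - x by lra.
have y'0 : 0 <= 1 - y by lra.
apply: ler_sum_nat => l /andP[dl lm]; rewrite !mulr_suml.
apply: ler_sum_nat => k /andP[dk km]; rewrite !subKr.
(* Here k + l >= 2d > m, so the truncated subtraction is exact. *)
set e := (k + l - m.+1)%N.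
have hk z : z ^+ k = z ^+ (m - l).+1 * z ^+ e :> R.
  by rewrite -exprD; congr (_ ^+ _); rewrite /e; lia.
have hl z : z ^+ l = z ^+ (m - k).+1 * z ^+ e :> R.
  by rewrite -exprD; congr (_ ^+ _); rewrite /e; lia.
pose c := 'C(m, k)%:R * 'C(m, l)%:R * (x * y) ^+ (m - k).+1
          * ((1 - x) * (1 - y)) ^+ (m - l).+1.
rewrite [leLHS](_ : _ = c * (x * (1 - y)) ^+ e); last first.
  rewrite /c hk hl !exprMn !exprS; ring.
rewrite [leRHS](_ : _ = c * (y * (1 - x)) ^+ e); last first.
  rewrite /c hk hl !exprMn !exprS; ring.
rewrite ler_wpM2l ?lerXn2r ?nnegrE ?mulr_ge0 ?exprn_ge0 ?mulr_ge0 ?(ltW x0) ?(ltW y0)//.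
by nra.
Qed.

(** * Jump rates and monotonicity of the step operator *)

Lemma natr_div_itv {R : realType} {N n : nat} : (0 < n < N)%N ->
  (0 < n%:R / N%:R :> R) && (n%:R / N%:R < 1 :> R).
Proof.
move=> /andP[n0 nN]; have N0 : 0 < N%:R :> R by rewrite ltr0n; lia.
by apply/andP; split; [rewrite divr_gt0// ltr0n|rewrite ltr_pdivrMr// mul1r ltr_nat].
Qed.

Lemma rate_up_gt0 {R : realType} {m d N n : nat} : (d <= m)%N -> (0 < n < N)%N ->
  0 < rate_up R m d N n :> R.
Proof.
move=> dm nN; have /andP[x0 x1] := natr_div_itv (R := R) nN.
rewrite mulr_gt0 ?binom_ge_gt0 ?x0 ?ltW//.
by rewrite ltr0n subn_gt0; case/andP: nN.
Qed.

Lemma rate_downE {R : realType} {m d N n : nat} : (d <= m)%N -> (0 < n < N)%N ->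
  rate_down R m d N n = fine (gfun m d (n%:R / N%:R)) * rate_up R m d N n :> R.
Proof.
move=> dm nN; have /andP[x0 x1] := natr_div_itv (R := R) nN.
rewrite gfun_fineE ?gt_eqF// /rate_down /rate_up.
have N0 : N%:R != 0 :> R by rewrite pnatr_eq0; lia.
rewrite natrB; last lia.
rewrite mulrBl divff//; set x := _ / _ in x0 x1 *.
have -> : n%:R = x * N%:R :> R by rewrite mulfVK.
have b0 : binom_ge m x d != 0 by rewrite gt_eqF// binom_ge_gt0// x0 ltW.
have x'0 : 1 - x != 0 by rewrite gt_eqF// subr_gt0.
by field; rewrite b0 x'0.
Qed.

Lemma rate_down_gt0 {R : realType} {m d N n : nat} : (d <= m)%N -> (0 < n < N)%N ->
  0 < rate_down R m d N n :> R.
Proof.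
by move=> dm nN; rewrite rate_downE// mulr_gt0 ?gfun_gt0 ?natr_div_itv ?rate_up_gt0.
Qed.

(** At an interior state the step is an average with positive weights, hence order preserving;
    positivity, monotonicity in time and comparison all follow from this. *)
Lemma le_jump_step {R : realType} {m d N : nat} {f1 f2 : nat -> R} : (d <= m)%N ->
  (forall n, f1 n <= f2 n) ->
  forall n, jump_step m d N f1 n <= jump_step m d N f2 n.
Proof.
move=> dm f12 n; rewrite /jump_step; case: ifPn => // nN.
have {}nN : (0 < n < N)%N by lia.
have up0 := rate_up_gt0 (R := R) dm nN; have dn0 := rate_down_gt0 (R := R) dm nN.
by rewrite ler_wpM2r ?invr_ge0 ?addr_ge0 ?lerD ?ler_wpM2l// ltW.
Qed.

(** * Absorption probabilities and their harmonic majorant *)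

Section absorption.
Context {R : realType} {m d N : nat}.
Hypothesis dm : (d <= m)%N.

Lemma prob_at_N_after_ge0 k n : 0 <= prob_at_N_after R m d N k n :> R.
Proof.
elim: k n => [|k IH] n; first by rewrite /prob_at_N_after /= ler0n.
have step0 : jump_step m d N (fun=> 0) n = 0 :> R.
  by rewrite /jump_step; case: ifP => // _; rewrite !mulr0 addr0 mul0r.
by rewrite -[leLHS]step0; exact: le_jump_step.
Qed.

Lemma prob_at_N_after_nondecreasing n :
  nondecreasing_seq (fun k => prob_at_N_after R m d N k n : R).
Proof.
apply/nondecreasing_seqP => k; elim: k n => [|k IH] n; last exact: le_jump_step.
(* Base case: at an interior state the indicator of N is 0, so it suffices that one step gives a
   nonnegative value. *)
rewrite /prob_at_N_after iterS iter0 /jump_step; case: ifPn => // nN.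
have {}nN : (0 < n < N)%N by lia.
have -> : (n == N) = false by lia.
have up0 := rate_up_gt0 (R := R) dm nN; have dn0 := rate_down_gt0 (R := R) dm nN.
by rewrite divr_ge0 ?addr_ge0 ?(mulr_ge0 (ltW up0)) ?(mulr_ge0 (ltW dn0)) ?(ltW up0) ?(ltW dn0).
Qed.

(** Comparison principle: a superharmonic function above the indicator of N stays above all its
    iterates, by monotonicity of the step. *)
Lemma prob_at_N_after_le (phi : nat -> R) : (forall j, (j == N)%:R <= phi j) ->
  (forall j, jump_step m d N phi j <= phi j) ->
  forall k n, prob_at_N_after R m d N k n <= phi n.
Proof.
move=> phi0 phiS; elim=> [|k IH] n //=.
exact/(le_trans _ (phiS n))/le_jump_step.
Qed.

Lemma is_cvg_prob_at_N_after n : cvgn (fun k => prob_at_N_after R m d N k n : R).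
Proof.
apply: nondecreasing_is_cvgn; first exact: prob_at_N_after_nondecreasing.
(* The constant 1 is a harmonic majorant, so the nondecreasing sequence is bounded. *)
exists 1 => _ [k _ <-]; apply: (prob_at_N_after_le (fun=> 1)) => j.
  by case: eqP.
rewrite /jump_step; case: ifPn => // nN; have {}nN : (0 < j < N)%N by lia.
have up0 := rate_up_gt0 (R := R) dm nN; have dn0 := rate_down_gt0 (R := R) dm nN.
by rewrite !mulr1 divff// gt_eqF// addr_gt0.
Qed.

Lemma absorb_prob_le (phi : nat -> R) : (forall j, (j == N)%:R <= phi j) ->
  (forall j, jump_step m d N phi j <= phi j) ->
  forall n, absorb_prob R m d N n <= phi n.
Proof.
move=> phi0 phiS n; apply: limr_le; first exact: is_cvg_prob_at_N_after.
by apply: nearW => k; exact: prob_at_N_after_le.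
Qed.

Lemma absorb_prob_gt0 n : (0 < n <= N)%N -> 0 < absorb_prob R m d N n :> R.
Proof.
(* The path of N - n consecutive upward jumps already has positive probability, and the limit is at
   least the value after N - n steps. *)
move=> nN; apply: (@lt_le_trans _ _ (prob_at_N_after R m d N (N - n) n)); last first.
  apply: (nondecreasing_cvgn_le (u_ := fun k => prob_at_N_after R m d N k n)).
    exact: prob_at_N_after_nondecreasing.
  exact: is_cvg_prob_at_N_after.
have [k Nk] : exists k, (N - n = k)%N by eexists.
rewrite Nk; elim: k n nN Nk => [|k IH] n nN Nk.
  by have -> : n = N by [lia]; rewrite /prob_at_N_after/= eqxx.
rewrite /prob_at_N_after iterS -/(prob_at_N_after _ _ _ _ _) /jump_step ifF; last lia.
have {}nN : (0 < n < N)%N by lia.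
have up0 := rate_up_gt0 (R := R) dm nN; have dn0 := rate_down_gt0 (R := R) dm nN.
apply: divr_gt0; last exact: addr_gt0.
rewrite ltr_wpDr ?(mulr_ge0 (ltW dn0)) ?prob_at_N_after_ge0//.
by rewrite mulr_gt0// IH//; lia.
Qed.

Local Notation g k := (fine (@gfun R m d (k%:R / N%:R))).

Lemma prod_gfun_gt0 {j} : (j < N)%N -> 0 < \prod_(1 <= k < j.+1) g k.
Proof.
move=> jN; rewrite big_nat prodr_gt0// => k /andP[k1 kj].
by rewrite gfun_gt0// natr_div_itv//; lia.
Qed.

(** Gambler's ruin quotient, obtained as an upper bound from the comparison principle. *)
Lemma absorb_prob_le_ratio n : (0 < N)%N -> (n <= N)%N ->
  absorb_prob R m d N n <=
    (\sum_(0 <= j < n) \prod_(1 <= k < j.+1) g k) /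
    (\sum_(0 <= j < N) \prod_(1 <= k < j.+1) g k).
Proof.
move=> N0 nN.
pose P j := \prod_(1 <= k < j.+1) g k.
have P_gt0 j : (j < N)%N -> 0 < P j by exact: prod_gfun_gt0.
(* Positivity of [P j] is available for j < N only; the cap by [minn] makes [S] constant from N on,
   where the chain does not move. *)
pose S n := \sum_(0 <= j < minn n N) P j.
have S_ge0 j : 0 <= S j.
  by rewrite /S big_nat sumr_ge0// => i /andP[_ ij]; rewrite ltW// P_gt0//; lia.
have SN : 0 < S N.
  rewrite /S minnn big_ltn// ltr_pwDl ?P_gt0// big_nat sumr_ge0// => i /andP[_ ij].
  by rewrite ltW// P_gt0.
have -> : \sum_(0 <= j < N) P j = S N by rewrite /S minnn.
have -> : \sum_(0 <= j < n) P j = S n by rewrite /S (minn_idPl nN).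
apply: (absorb_prob_le (fun n => S n / S N)) => j.
  case: eqVneq => [->|_]; first by rewrite divff ?gt_eqF.
  by rewrite divr_ge0// ltW.
rewrite /jump_step; case: ifPn => // jN; have {}jN : (0 < j < N)%N by lia.
have up0 := rate_up_gt0 (R := R) dm jN; have dn0 := rate_down_gt0 (R := R) dm jN.
rewrite ler_pdivrMr ?addr_gt0// le_eqVlt; apply/orP; left; apply/eqP.
(* Harmonicity amounts to up rate times P(j) = down rate times P(j-1), which holds as P(j) = P(j-1)
   g(j/N) and g is the ratio of the rates. *)
have [S1 S2] : S j.+1 = S j.-1 + P j.-1 + P j /\ S j = S j.-1 + P j.-1.
  case: j jN {up0 dn0} => // j jN; rewrite /S.
  have [-> -> ->] : [/\ minn j.+2 N = j.+2, minn j.+1 N = j.+1 & minn j N = j]%N.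
    by split; lia.
  by rewrite !big_nat_recr.
have PS : P j = P j.-1 * g j.
  by case: j jN {up0 dn0 S1 S2} => // j jN; rewrite /P big_nat_recr.
rewrite S1 S2 PS rate_downE//; ring.
Qed.

End absorption.

(** * Limit superior, integrals of monotone functions, growth of the logarithm *)

Lemma limn_esup_le_near {R : realType} (u : (\bar R)^nat) (l : \bar R) :
  (\forall n \near \oo, (u n <= l)%E) -> (limn_esup u <= l)%E.
Proof.
move=> [N _ uN]; rewrite limn_esup_lim.
apply: lime_le; first exact: is_cvg_esups.
near=> n; apply: ge_ereal_sup => _ [k /= nk <-].
by apply: uN => /=; apply: leq_trans nk; near: n; exists N.
Unshelve. all: by end_near. Qed.

(** Composition with the clamp onto [a, b] extends f to a nonincreasing function on the whole
    line. *)
Lemma nonincreasing_itv_measurable {R : realType} (f : R -> R) a b : a <= b ->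
  {in `[a, b] &, nonincreasing_fun f} ->
  measurable_fun `[a, b] f.
Proof.
move=> ab f_ni.
pose clip x := Num.max a (Num.min x b).
have clip_itv x : clip x \in `[a, b].
  by rewrite in_itv/= le_max lexx/= ge_max ab ge_min lexx orbT.
apply: (eq_measurable_fun (f \o clip)) => [x|].
  rewrite inE/= in_itv/= => /andP[ax xb].
  by rewrite /clip (min_idPl xb) (max_idPr ax).
apply: nonincreasing_measurable => // x y xy /=; apply: f_ni => //.
by rewrite /clip le_max2 ?le_min2.
Qed.

(** Peels off [[a, c[], where f is at most f(a); iteration yields an upper Riemann sum. *)
Lemma integral_nonincreasing_le {R : realType} {f : R -> R} {a c b} :
  a <= c <= b -> {in `[a, b] &, nonincreasing_fun f} ->
  {in `[a, b], forall x, 0 <= f x} ->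
  (\int[@lebesgue_measure R]_(x in `[a, b]) (f x)%:E <=
   ((c - a) * f a)%:E + \int[@lebesgue_measure R]_(x in `[c, b]) (f x)%:E)%E.
Proof.
move=> /andP[ac cb] f_ni f0.
have ab := le_trans ac cb.
have mf : measurable_fun `[a, b] (fun x => (f x)%:E).
  by apply/measurable_EFinP; exact: nonincreasing_itv_measurable.
have U : (`[a, b] = `[a, c[ `|` `[c, b])%classic.
  by apply: itv_bndbnd_setU; rewrite bnd_simp.
have subac : (`[a, c[ `<=` `[a, b])%classic by rewrite U; exact: subsetUl.
rewrite U ge0_integral_setU//=; last 3 first.
- by rewrite -U.
- by move=> x xab; rewrite lee_fin f0//; suff: `[a, b]%classic x by []; rewrite U.
- rewrite disj_set2E; apply/eqP/seteqP; split => // x [] /=; rewrite !in_itv/=.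
  by move=> /andP[_ xc] /andP[cx _]; move: (lt_le_trans xc cx); rewrite ltxx.
rewrite leeD2r//.
apply: (@le_trans _ _ (\int[@lebesgue_measure R]_(x in `[a, c[) (cst (f a)%:E) x)%E).
  apply: ge0_le_integral => //.
  - by move=> x /subac xab; rewrite lee_fin f0.
  - exact: measurable_funS mf.
  - move=> x /subac xab; rewrite lee_fin f_ni ?in_itv/= ?lexx//.
    by move: xab; rewrite /= in_itv/= => /andP[].
rewrite integral_cst//= lebesgue_measure_itv/= lte_fin.
case: ltP => [_|ca]; first by rewrite -EFinB -EFinM mulrC.
by rewrite mule0 lee_fin mulr_ge0 ?subr_ge0// f0// in_itv/= lexx.
Qed.

(** Left endpoints give an upper sum; the induction removes the leftmost cell. The last cell may
    extend beyond b, so only the grid points are required to stay below b. *)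
Lemma integral_nonincreasing_le_sum {R : realType} (f : R -> R) (a b h : R) (n : nat) :
  0 <= h -> a <= b <= a + h *+ n.+1 ->
  {in `[a, b] &, nonincreasing_fun f} -> {in `[a, b], forall x, 0 <= f x} ->
  (forall i, (i < n.+1)%N -> a + h *+ i <= b) ->
  (\int[@lebesgue_measure R]_(x in `[a, b]) (f x)%:E <=
   (h * \sum_(0 <= i < n.+1) f (a + h *+ i))%:E)%E.
Proof.
move=> h0; elim: n a => [|n IH] a /andP[ab bah] f_ni f0 ahb.
  (* With c = b the remaining integral is over a single point. *)
  have abb : a <= b <= b by rewrite ab lexx.
  apply: (le_trans (integral_nonincreasing_le abb f_ni f0)).
  rewrite set_itv1 integral_set1 adde0 lee_fin big_nat1 mulr0n addr0.
  by rewrite ler_wpM2r ?f0 ?in_itv/= ?lexx// lerBlDl.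
have hb : a + h <= b by rewrite -[h]mulr1n ahb.
have sub x : x \in `[a + h, b] -> x \in `[a, b].
  by rewrite !in_itv/= => /andP[+ ->]; rewrite andbT; apply: le_trans; rewrite lerDl.
have ahb' : a <= a + h <= b by rewrite lerDl h0.
apply: (le_trans (integral_nonincreasing_le ahb' f_ni f0)).
rewrite big_nat_recl// mulrDr EFinD mulr0n addr0 [a + h - a]addrAC subrr add0r leeD2l//.
have E i : a + h *+ i.+1 = a + h + h *+ i by rewrite mulrS addrA.
under eq_bigr do rewrite E.
apply: IH.
- by rewrite hb -E.
- by move=> x y /sub xab /sub yab; exact: f_ni.
- by move=> x /sub; exact: f0.
- by move=> i i_n; rewrite -E ahb.
Qed.

(** Write x as the square of its root s and use ln s <= s. *)
Lemma ln_le_sqrt {R : realType} {x : R} : 0 < x -> ln x <= 2 * Num.sqrt x.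
Proof.
move=> x0; have s0 : 0 < Num.sqrt x by rewrite sqrtr_gt0.
rewrite -{1}(sqr_sqrtr (ltW x0)) expr2 lnM ?posrE//.
by have := ln_sublinear s0; lra.
Qed.

Lemma near_ln_div_le {R : realType} (c e : R) : 0 < e ->
  \forall N \near \oo, (ln N%:R + c) / N%:R <= e.
Proof.
move=> e0.
near=> N.
have N1 : 1 <= N%:R :> R by near: N; exact: nbhs_infty_ger.
have N0 : 0 < N%:R :> R by exact: lt_le_trans N1.
(* With s = sqrt N >= 1, this threshold gives ln N + c <= 2 s + |c| <= (2 + |c|) s <= e s^2 = e
   N. *)
have Nc : ((2 + `|c|) / e) ^+ 2 <= N%:R by near: N; exact: nbhs_infty_ger.
rewrite ler_pdivrMr//.
have s1 : 1 <= Num.sqrt (N%:R : R) by rewrite -[leLHS]sqrtr1 ler_sqrt.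
have sc : (2 + `|c|) / e <= Num.sqrt N%:R.
  rewrite -[leLHS]ger0_norm; last by rewrite divr_ge0 ?addr_ge0// ltW.
  by rewrite -sqrtr_sqr ler_sqrt.
rewrite ler_pdivrMr// in sc.
have := ln_le_sqrt N0; have := ler_norm c; have := normr_ge0 c.
rewrite -{4}(sqr_sqrtr (ltW N0)).
move: (ln _) (Num.sqrt _) s1 sc => l s s1 sc; nra.
Unshelve. all: by end_near. Qed.

(** * Bounds on h_N for fixed N *)

Section fixation_bound.
Context {R : realType} {m d N : nat}.
Hypotheses (m2 : (2 <= m)%N) (md : (m < 2 * d)%N) (dm : (d <= m)%N).

Local Notation g k := (fine (@gfun R m d (k%:R / N%:R))).

Lemma gfun_div_ge1 k : (0 < k)%N -> (2 * k <= N)%N -> 1 <= g k.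
Proof.
move=> k0 kN; apply: gfun_ge1 => //.
have N0 : 0 < N%:R :> R by rewrite ltr0n; lia.
apply/andP; split; first by rewrite divr_gt0// ltr0n.
rewrite ler_pdivrMr// mulrC ler_pdivlMr// -natrM ler_nat mulnC//.
Qed.

(** Factors at least 1 make P nondecreasing up to M, so the numerator is at most (l + 1) P(l), while
    the denominator is at least its single term P(M). Allowing n up to l + 1 covers both
    interpolation nodes. *)
Lemma absorb_prob_le_prod n l M : (n <= l.+1)%N -> (l < M)%N -> (2 * M <= N)%N ->
  absorb_prob R m d N n <= l.+1%:R / \prod_(l.+1 <= k < M.+1) g k.
Proof.
move=> nl lM MN; have N0 : (0 < N)%N by lia.
apply: le_trans; first by apply: absorb_prob_le_ratio => //; lia.
pose P j := \prod_(1 <= k < j.+1) g k.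
have P0 j : (j < N)%N -> 0 < P j by move=> jN; exact: prod_gfun_gt0.
have Pcat i j : (i <= j)%N -> P j = P i * \prod_(i.+1 <= k < j.+1) g k.
  by move=> ij; rewrite /P -big_cat_nat.
have prod_ge1 i j : (2 * j <= N)%N -> 1 <= \prod_(i.+1 <= k < j.+1) g k.
  move=> jN; rewrite big_nat; elim/big_ind: _ => // [x y x1 y1|k kj].
    exact: mulr_ege1.
  by apply: gfun_div_ge1; lia.
have prodM0 := lt_le_trans ltr01 (prod_ge1 l M MN).
rewrite ler_pdivlMr// mulrAC ler_pdivrMr; last first.
  rewrite big_ltn// ltr_pwDl ?P0//.
  by rewrite big_nat sumr_ge0// => j /andP[_ jN]; rewrite ltW// P0.
apply: (@le_trans _ _ (l.+1%:R * P l * \prod_(l.+1 <= k < M.+1) g k)).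
  rewrite ler_wpM2r ?(ltW prodM0)//.
  apply: (@le_trans _ _ (\sum_(0 <= j < n) P l)).
    apply: ler_sum_nat => j /andP[_ jn]; rewrite (Pcat j l) ?ler_peMr ?prod_ge1//; try lia.
    by rewrite ltW// P0//; lia.
  rewrite sumr_const_nat subn0 -[leLHS]mulr_natl ler_wpM2r ?ler_nat//.
  by rewrite ltW// P0//; lia.
rewrite -mulrA -Pcat 1?ltnW// ler_wpM2l//.
rewrite (@big_cat_nat _ _ _ M)//=; [|lia..].
rewrite [X in _ + X]big_ltn; last lia.
rewrite addrCA lerDl addr_ge0// big_nat sumr_ge0// => j /andP[_ jN];
  by rewrite ltW// P0//; lia.
Qed.

(** h_N(alpha) is the absorption probability at l or a convex combination of those at l and l + 1,
    and both obey the same bound. *)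
Lemma hN_le_prod (alpha : R) (M : nat) : 0 < alpha ->
  (Num.truncn (alpha * N%:R) < M)%N -> (2 * M <= N)%N ->
  hN m d N alpha <= (Num.truncn (alpha * N%:R)).+1%:R /
    \prod_((Num.truncn (alpha * N%:R)).+1 <= k < M.+1) g k.
Proof.
move=> a0; rewrite /hN; set l := Num.truncn _ => lM MN.
have /andP[lx xl] : l%:R <= alpha * N%:R < l.+1%:R.
  by rewrite truncn_itv// mulr_ge0// ltW.
have hl := absorb_prob_le_prod l l M (leqnSn l) lM MN.
have hl1 := absorb_prob_le_prod l.+1 l M (leqnn _) lM MN.
case: ifP => // _.
move: (_ / _) hl hl1 => b hl hl1.
have lS : l.+1%:R = l%:R + 1 :> R by rewrite -natr1.
rewrite lS in xl *; nra.
Qed.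

(* Needed because [ln 0 = 0] in the library: an upper bound on [hN] alone would
   not bound [ln hN] by a negative number. *)
Lemma hN_gt0 (alpha : R) : 0 < alpha ->
  (0 < Num.truncn (alpha * N%:R) < N)%N -> 0 < hN m d N alpha.
Proof.
move=> a0; rewrite /hN; set l := Num.truncn _ => /andP[l0 lN].
have /andP[lx xl] : l%:R <= alpha * N%:R < l.+1%:R.
  by rewrite truncn_itv// mulr_ge0// ltW.
have hl : 0 < absorb_prob R m d N l by apply: absorb_prob_gt0 => //; lia.
have hl1 : 0 < absorb_prob R m d N l.+1 by apply: absorb_prob_gt0 => //; lia.
case: ifP => // _; apply: ltr_wpDl.
  by rewrite mulr_ge0 ?subr_ge0// ltW.
by rewrite mulr_gt0// subr_gt0.
Qed.

(** The two size conditions on N give l >= 1, used for h_N > 0, and l + 1 <= N/2, so that the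
    product of the g(k/N) has a nonempty range. *)
Lemma ln_hN_le (alpha : R) : 0 < alpha < 2^-1 -> 1 <= alpha * N%:R ->
  1 <= (2^-1 - alpha) * N%:R ->
  (((N%:R)^-1 * ln (hN m d N alpha))%:E <=
   ((ln N%:R + ln (fine (gfun m d alpha))) / N%:R)%:E
   - \int[@lebesgue_measure R]_(x in `[alpha, 2^-1%R])
       (ln (fine (gfun m d x)))%:E)%E.
Proof.
pose f (x : R) := ln (fine (gfun m d x)).
move=> /andP[a0 ah] aN1 aN2.
have N0 : 0 < N%:R :> R by case: (N) aN1 => [|n] *; [lra|rewrite ltr0n].
have gt0 : 0 < N%:R^-1 :> R by rewrite invr_gt0.
have := @hN_le_prod alpha N./2 a0; have := @hN_gt0 alpha a0.
set l := Num.truncn _; set M := N./2.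
have /andP[lx xl] : l%:R <= alpha * N%:R < l.+1%:R.
  by rewrite truncn_itv// mulr_ge0// ltW.
have l0 : (0 < l)%N by rewrite truncn_gt0.
have lN : (2 * l.+1 <= N)%N.
  by rewrite -(ler_nat R) natrM -natr1; lra.
have [lM MN NM] : [/\ l < M, 2 * M <= N & N < 2 * M.+1]%N by rewrite /M; split; lia.
have lN' : (l < N)%N by lia.
have g0 k : (l.+1 <= k < M.+1)%N -> 0 < g k.
  by move=> kM; apply: lt_le_trans ltr01 _; apply: gfun_div_ge1; lia.
(* The grid points (l+1)/N, ..., M/N do not exceed 1/2, and one further step reaches or passes
   it. *)
have Mh : (N <= (l.+1 + (M - l.+1).+1) * 2)%N by lia.
have iMh i : (i < (M - l.+1).+1)%N -> ((l.+1 + i) * 2 <= N)%N by lia.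
rewrite l0/= => /(_ lN') h0 /(_ lM MN) hle.
(* Positivity is carried through the induction because the logarithm of a product requires it. *)
have lnprod : ln (\prod_(l.+1 <= k < M.+1) g k) = \sum_(l.+1 <= k < M.+1) ln (g k)
    /\ 0 < \prod_(l.+1 <= k < M.+1) g k.
  rewrite big_nat [X in _ = X /\ _]big_nat; elim/big_ind2: _ => //.
    by rewrite ln1.
  - by move=> x1 x2 y1 y2 [<- x0] [<- y0]; rewrite lnM// mulr_gt0.
  - by move=> k /g0.
case: lnprod => lnprod prod0.
set s := \sum_(_ <= k < _) _ in lnprod.
have lnh : ln (hN m d N alpha) <= ln N%:R - s.
  apply: (@le_trans _ _ (ln (l.+1%:R / \prod_(l.+1 <= k < M.+1) g k))).
    by rewrite ler_ln ?posrE// divr_gt0.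
  have l1N : l.+1%:R <= N%:R :> R by rewrite ler_nat.
  by rewrite ln_div ?posrE// lnprod lerD2r ler_ln ?posrE.
have f_ge0 x : x \in `[alpha, 2^-1] -> 0 <= f x.
  rewrite in_itv/= => /andP[ax xh]; apply: ln_ge0; apply: gfun_ge1 => //.
  by rewrite xh (lt_le_trans a0).
have f_ni : {in `[alpha, 2^-1] &, nonincreasing_fun f}.
  move=> x y; rewrite !in_itv/= => /andP[ax xh] /andP[ay yh] xy.
  by rewrite /f ler_ln ?posrE ?gfun_gt0 ?gfun_nonincreasing//; lra.
(* First grid point to the right of alpha, at distance at most 1/N: the cell [alpha, c] costs at
   most f(alpha)/N, and the rest is compared with [s]. *)
pose c := l.+1%:R / N%:R : R.
have ac : alpha <= c by rewrite /c ler_pdivlMr// ltW.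
have ch : c <= 2^-1.
  by rewrite /c ler_pdivrMr// mulrC ler_pdivlMr// -natrM ler_nat mulnC.
have cE i : c + N%:R^-1 *+ i = (l.+1 + i)%:R / N%:R.
  by rewrite natrD mulrDl [i%:R * _]mulr_natl.
have int_le : (\int[@lebesgue_measure R]_(x in `[alpha, 2^-1%R]) (f x)%:E <=
    (N%:R^-1 * (f alpha + s))%:E)%E.
  have ach : alpha <= c <= 2^-1 by rewrite ac ch.
  apply: (le_trans (integral_nonincreasing_le ach f_ni f_ge0)).
  rewrite mulrDr EFinD; apply: leeD.
    rewrite lee_fin ler_wpM2r ?f_ge0 ?in_itv/= ?lexx ?(ltW ah)//.
    rewrite /c -natr1 mulrDl mul1r lerBlDr addrC lerD2l.
    by rewrite ler_pdivrMr.
  have sub x : x \in `[c, 2^-1] -> x \in `[alpha, 2^-1].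
    by rewrite !in_itv/= => /andP[+ ->]; rewrite andbT; apply: le_trans.
  apply: (@le_trans _ _ (N%:R^-1 * \sum_(0 <= i < (M - l.+1).+1) f (c + N%:R^-1 *+ i))%:E).
    apply: integral_nonincreasing_le_sum.
    - exact: ltW.
    - by rewrite ch cE/= ler_pdivlMr// mulrC ler_pdivrMr// -natrM ler_nat.
    - by move=> x y /sub xa /sub ya; exact: f_ni.
    - by move=> x /sub; exact: f_ge0.
    - by move=> i iM; rewrite cE ler_pdivrMr// mulrC ler_pdivlMr// -natrM ler_nat iMh.
  rewrite lee_fin ler_wpM2l ?(ltW gt0)//.
  rewrite /s -{2}(add0n l.+1) big_addn subSn// le_eqVlt; apply/orP; left; apply/eqP.
  by apply: eq_bigr => i _; rewrite cE addnC.
(* Adding and subtracting f(alpha)/N makes the upper bound of the integral appear. *)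
apply: (@le_trans _ _ (((ln N%:R + f alpha) / N%:R)%:E - (N%:R^-1 * (f alpha + s))%:E)%E).
  rewrite -EFinB lee_fin [leRHS](_ : _ = N%:R^-1 * (ln N%:R - s)); last by ring.
  by rewrite ler_wpM2l// ltW.
by rewrite leeD2l// leeN2.
Qed.

End fixation_bound.

Theorem theorem2 (R : realType) (m d : nat) :
  (2 <= m)%N -> (m < 2 * d)%N -> (d <= m)%N ->
  (forall x : R, 0 <= x < 2^-1 -> (1%:E < gfun m d x)%E) /\
  (forall alpha : R, 0 < alpha < 2^-1 ->
     (limn_esup (fun N : nat => ((N%:R)^-1 * ln (hN m d N alpha))%:E)
      <= - (\int[@lebesgue_measure R]_(x in `[alpha, 2^-1%R]) (ln (fine (gfun m d x)))%:E))%E).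
Proof.
move=> m2 md dm; split=> [x xh|alpha ah]; first exact: gfun_gt1.
have /andP[a0 a12] := ah.
(* The slack e absorbs the error (ln N + ln g(alpha))/N for large N. *)
apply/lee_addgt0Pr => e e0; apply: limn_esup_le_near.
near=> N.
have aN1 : 1 <= alpha * N%:R.
  by rewrite mulrC -ler_pdivrMr//; near: N; exact: nbhs_infty_ger.
have aN2 : 1 <= (2^-1 - alpha) * N%:R.
  by rewrite mulrC -ler_pdivrMr ?subr_gt0//; near: N; exact: nbhs_infty_ger.
apply: (le_trans (ln_hN_le m2 md dm alpha ah aN1 aN2)).
rewrite addeC leeD2l// lee_fin.
by near: N; exact: near_ln_div_le.
Unshelve. all: by end_near. Qed.
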